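(* For each positive integer $n$ let $S=\{1,\ldots,n\}\subset\mathbb{Z}_+$, and let $G_1$, $G$, $G_d$ be the TT cores (defined in the context) of the order $d$ Smith tensor $(S_d)$, $((S_d))_{i_1,\ldots,i_d}=\gcd(i_1,\ldots,i_d)$. Then the number ${\rm nz}(n)$ of nonzero elements in each one of the TT cores $G_1$, $G$, and $G_d$ satisfies $${\rm nz}(n)=n\ln n+(2\gamma-1)n+\mathcal{O}(\sqrt{n})\quad\text{as }n\to\infty,$$ where $\gamma$ denotes the Euler--Mascheroni constant.
   Context: The Smith tensor $(S_d)$ is the $n$-dimensional tensor of order $d$ with entries $\gcd(i_1,\ldots,i_d)$, $i_1,\ldots,i_d\in\{1,\ldots,n\}$. Its TT cores, which represent it as $((S_d))_{i_1,\ldots,i_d}=G_1(i_1)\left(\prod_{k=2}^{d-1}G(i_k)\right)G_d(i_d)$, are the arrays given for $i,j,k\in\{1,\ldots,n\}$ by $$G_1(i)_{1,j}=D_jE_{i,j},\quad G(i)_{j,k}=\delta_{j,k}E_{i,k},\quad G_d(i)_{j,1}=E_{i,j},$$ where $\delta_{j,k}$ is the Kronecker delta, $E_{i,j}=1$ if $j\mid i$ and $E_{i,j}=0$ otherwise, and $$D_k=\sum_{\substack{z\mid k\\ z\nmid j,\ j<k}}\ \sum_{y\mid z}y\,\mu(z/y),$$ where the outer sum is over positive integers $z$ dividing $k$ and dividing no positive integer $j<k$, and $\mu$ is the arithmetic Möbius function ($D_k=\phi(k)$, Euler's totient function). Each core is viewed as a three-dimensional array of numbers indexed by $i$ and the matrix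 indices, and ${\rm nz}(n)$ counts its nonzero entries. *)

(* Defs.v *)
From HB Require Import structures.
From mathcomp Require Import all_boot all_order all_algebra.
From mathcomp Require Import all_classical all_reals all_analysis.

Set Implicit Arguments.
Unset Strict Implicit.
Unset Printing Implicit Defensive.

Import Order.TTheory GRing.Theory Num.Theory.
Import numFieldNormedType.Exports.

Local Open Scope ring_scope.

Definition mobius (n : nat) : int :=
  if (0 < n)%N && all (fun p => logn p n == 1%N) (primes n)
  then (-1) ^+ size (primes n) else 0.

Definition smithE (i j : nat) : int := if (j %| i)%N then 1 else 0.

Definition smithD (k : nat) : int :=
  \sum_(z <- divisors k | [forall j : 'I_k, (0 < j)%N ==> ~~ (z %| j)%N])
    \sum_(y <- divisors z) y%:Z * mobius (z %/ y).

(* An index i : 'I_n stands for the element i.+1 of {1, ..., n}, and a core is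
   a family of matrices indexed by 'I_n. *)

Definition core_first (n : nat) (i : 'I_n) : 'M[int]_(1, n) :=
  \row_j (smithD j.+1 * smithE i.+1 j.+1).

Definition core_mid (n : nat) (i : 'I_n) : 'M[int]_(n, n) :=
  \matrix_(j, k) ((j == k)%:R * smithE i.+1 k.+1).

Definition core_last (n : nat) (i : 'I_n) : 'M[int]_(n, 1) :=
  \col_j smithE i.+1 j.+1.

Definition nz (n r s : nat) (G : 'I_n -> 'M[int]_(r, s)) : nat :=
  #|[set t : 'I_n * 'I_r * 'I_s | G t.1.1 t.1.2 t.2 != 0]|.

(* [series harmonic n] is the sum of 1/k for 1 <= k <= n. *)
Definition euler_mascheroni (R : realType) : R :=
  limn (fun n : nat => series (@harmonic R) n - ln n%:R).

(* Main.v *)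
Require Import Defs.
From mathcomp Require Import all_boot all_order all_algebra.
From mathcomp Require Import all_classical all_reals all_analysis.
From mathcomp Require Import zify ring lra.
Import Order.TTheory GRing.Theory Num.Theory.
Import numFieldNormedType.Exports.
Local Open Scope classical_set_scope.
Local Open Scope ring_scope.

(** Each core is supported on the pairs [(i, j)] with [j] dividing [i]: the
    Kronecker delta and the weights [D_j] kill nothing else, because
    [D_j = phi(j)] is positive.  Hence all three counts equal the divisor
    summatory function [T(n) = sum_(j <= n) floor(n / j)], and the claim is
    Dirichlet's theorem on the average order of the number of divisors.

    [D_k = phi(k)]: the only divisor of [k] that divides no smaller positive
    integer is [k] itself, so [D_k = sum_(y | k) y mu(k / y)].  If [p] is a
    prime and [k = p ^ a * m] with [p] not dividing [m] and [a > 0], then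
    [mu(k / y)] vanishes unless [y = p ^ a * e] or [y = p ^ (a - 1) * e] with
    [e] dividing [m], and the two contributions have opposite signs; so the sum
    is [p ^ a - p ^ (a - 1) = phi(p ^ a)] times the same sum for [m]
    ([sum_divisors_mobius]).

    Asymptotics: let [u = floor(sqrt n)].  Counting the lattice points under
    the hyperbola [j k = n] by symmetry gives
    [T(n) = 2 sum_(j <= u) floor(n / j) - u ^ 2] ([hyperbola]).  Here
    dropping the floors costs [O(u)]; the harmonic number [H_u] is
    [ln u + gamma + O(1 / u)] ([harmonic_ln_euler]), so replacing it costs
    [n O(1 / u) = O(u)]; and replacing [2 ln u] by [ln n] and [u ^ 2] by [n]
    also costs only [O(u)], as [u ^ 2 <= n <= u ^ 2 + 2 u].  What remains is
    [n ln n + 2 gamma n - n].  Keeping track of the constants gives the error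
    bound [8 sqrt n] for every [n > 0] ([divisor_summatory_bound]). *)

(** * Moebius inversion for the totient *)

(** Removing one prime at a time from [k] needs its divisors listed according
    to their [p]-adic valuation [b]. *)
Lemma divisors_pfactorM p a m : prime p -> coprime p m -> (0 < m)%N ->
  perm_eq (divisors (p ^ a * m))
          [seq (p ^ b * e)%N | b <- iota 0 a.+1, e <- divisors m].
Proof.
move=> p_pr co_pm m_gt0; have p_gt0 := prime_gt0 p_pr.
have k_gt0 : (0 < p ^ a * m)%N by rewrite muln_gt0 expn_gt0 p_gt0.
have logpE b e : e \in divisors m -> logn p (p ^ b * e) = b.
  rewrite -dvdn_divisors // => /dvdnP[c mE].
  have e_gt0 : (0 < e)%N by case: e mE m_gt0 => //; rewrite muln0 => ->.
  have co_pe : coprime p e by move: co_pm; rewrite mE coprimeMr => /andP[].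
  by rewrite lognM ?expn_gt0 ?p_gt0 // pfactorK // (logn_coprime co_pe) addn0.
apply: uniq_perm; first exact: divisors_uniq.
  apply: allpairs_uniq; [exact: iota_uniq | exact: divisors_uniq|].
  move=> [b e] [b' e'] /allpairsP[x [_ xe [-> ->]]].
  move=> /allpairsP[y [_ ye [-> ->]]].
  move=> /= eqxy; have eqb : x.1 = y.1.
    by rewrite -(logpE x.1 x.2) // eqxy logpE.
  move: eqxy; rewrite eqb => /eqP.
  by rewrite eqn_pmul2l ?expn_gt0 ?p_gt0 // => /eqP ->.
move=> d; rewrite -dvdn_divisors //; apply/idP/allpairsP => [d_dvd | [[b e]]].
  have d_gt0 : (0 < d)%N by exact: dvdn_gt0 d_dvd.
  have [e co_pe dE] := pfactor_coprime p_pr d_gt0.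
  exists (logn p d, e); split; last by rewrite mulnC.
    rewrite mem_iota add0n ltnS.
    by move: (dvdn_leq_log p k_gt0 d_dvd); rewrite (logpE a m) ?divisors_id.
  rewrite -[(_, e).2]/e -dvdn_divisors // -(@Gauss_dvdr _ (p ^ a)); last first.
    by rewrite coprime_sym coprimeXl.
  by apply: dvdn_trans d_dvd; rewrite dE dvdn_mulr.
rewrite -[(b, e).1]/b -[(b, e).2]/e mem_iota add0n ltnS -dvdn_divisors //.
move=> -[b_le e_dvd ->].
by rewrite dvdn_mul // dvdn_exp2l.
Qed.

Lemma mobius_sqr p d : prime p -> (0 < d)%N -> (p ^ 2 %| d)%N -> mobius d = 0.
Proof.
move=> p_pr d_gt0 p2d; rewrite /mobius d_gt0 /=; case: ifP => // /allP/(_ p).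
rewrite mem_primes p_pr d_gt0 (dvdn_trans _ p2d) ?dvdn_exp //.
move=> /(_ isT)/eqP l1.
by move: p2d; rewrite pfactor_dvdn // l1.
Qed.

Lemma mobius_primeM p e : prime p -> coprime p e -> (0 < e)%N ->
  mobius (p * e) = - mobius e.
Proof.
move=> p_pr co_pe e_gt0; have p_gt0 := prime_gt0 p_pr.
have pNe : p \notin primes e.
  by rewrite mem_primes p_pr e_gt0 -prime_coprime // co_pe.
have perm_primes : perm_eq (primes (p * e)) (p :: primes e).
  apply: uniq_perm; rewrite /= ?primes_uniq ?pNe // => q.
  by rewrite primesM // primes_prime // !inE.
rewrite /mobius muln_gt0 p_gt0 e_gt0 /= (perm_all _ perm_primes).
rewrite (perm_size perm_primes) /=.
rewrite lognM // logn_prime // eqxx (logn_coprime co_pe) /=.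
rewrite (@eq_in_all _ _ (fun q => logn q e == 1%N)); last first.
  move=> q qe; rewrite lognM // (logn_prime q p_pr).
  by have [qp|] := eqVneq q p; first by rewrite -qp qe in pNe.
by case: ifP => _; rewrite ?oppr0 // exprS mulN1r.
Qed.

(** The identity [id * mu = phi] for Dirichlet convolution.  Splitting off the
    full power of one prime reduces [k] to a smaller [m]: only the two highest
    exponents of [p] in [y] leave [k / y] free of the square [p ^ 2]. *)
Lemma sum_divisors_mobius k : (0 < k)%N ->
  \sum_(y <- divisors k) y%:Z * mobius (k %/ y) = (totient k)%:Z.
Proof.
have [n] := ubnP k; elim: n k => // n IHn k; rewrite ltnS => k_le k_gt0.
have [k_le1|k_gt1] := leqP k 1.
  have -> : k = 1%N by apply/eqP; rewrite eqn_leq k_le1.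
  by rewrite /= big_seq1.
set p := pdiv k; have p_pr : prime p := pdiv_prime k_gt1.
have p_gt0 := prime_gt0 p_pr.
have [m co_pm kE] := pfactor_coprime p_pr k_gt0.
have a_gt0 : (0 < logn p k)%N.
  by rewrite logn_gt0 mem_primes p_pr k_gt0 pdiv_dvd.
case: (logn p k) a_gt0 kE => // a _; rewrite mulnC => kE.
have m_gt0 : (0 < m)%N by move: k_gt0; rewrite kE muln_gt0 => /andP[].
have m_lt : (m < n)%N.
  apply: leq_trans k_le; rewrite kE ltn_Pmull // -(expn0 p) ltn_exp2l //.
  exact: prime_gt1.
rewrite {1}kE (perm_big _ (divisors_pfactorM _ _ _ p_pr co_pm m_gt0)).
(* Exponents [b < a] of [p] in [y] give a multiple [k / y] of [p ^ 2]. *)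
rewrite big_allpairs_dep -[X in iota _ X]addn2 iotaD add0n big_cat /=.
rewrite big1_seq ?add0r => [|b]; last first.
  rewrite mem_iota add0n => /andP[_ b_lt]; rewrite big1_seq // => e /andP[_].
  rewrite -dvdn_divisors // => /dvdnP[c mE].
  have [c_gt0 e_gt0] : (0 < c)%N /\ (0 < e)%N.
    by apply/andP; rewrite -muln_gt0 -mE.
  have be_gt0 : (0 < p ^ b * e)%N by rewrite muln_gt0 expn_gt0 p_gt0.
  have kdE : (k = p ^ (a.+1 - b) * c * (p ^ b * e))%N.
    by rewrite mulnACA -expnD subnK ?(leqW (ltnW b_lt)) // -mE.
  rewrite [X in mobius (X %/ _)]kdE mulnK // (@mobius_sqr p) ?mulr0 //.
    by rewrite muln_gt0 expn_gt0 p_gt0 c_gt0.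
  by rewrite dvdn_mulr // dvdn_exp2l // ltn_subRL addn1.
rewrite big_cons big_seq1 -big_split /=.
rewrite kE totient_coprime ?coprimeXl // totient_pfactor //= PoszM -IHn //.
rewrite mulr_sumr.
apply: eq_big_seq => e; rewrite -dvdn_divisors // => /dvdnP[c mE].
have [c_gt0 e_gt0] : (0 < c)%N /\ (0 < e)%N.
  by apply/andP; rewrite -muln_gt0 -mE.
have co_pc : coprime p c by move: co_pm; rewrite mE coprimeMr => /andP[].
have -> : (p ^ a.+1 * m %/ (p ^ a * e) = p * c)%N.
  by rewrite mE expnS mulnACA mulnK ?muln_gt0 ?expn_gt0 ?p_gt0.
have -> : (p ^ a.+1 * m %/ (p ^ a.+1 * e) = c)%N.
  by rewrite mE mulnCA mulnK ?muln_gt0 ?expn_gt0 ?p_gt0.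
rewrite mobius_primeM // mE mulnK // expnS -(prednK p_gt0) !PoszM /=.
rewrite -[Posz p.-1.+1]/(1 + p.-1 : int)%R.
ring.
Qed.

Lemma smithD_totient k : (0 < k)%N -> smithD k = totient k.
Proof.
move=> k_gt0; rewrite -sum_divisors_mobius // /smithD.
rewrite big_mkcond (bigD1_seq k) ?divisors_id ?divisors_uniq //=.
rewrite ifT; last first.
  apply/forallP => j; apply/implyP => j_gt0.
  by apply/negP => /(dvdn_leq j_gt0); rewrite leqNgt ltn_ord.
rewrite -[RHS]addr0; congr (_ + _).
rewrite big1_seq // => z /andP[z_neq]; rewrite -dvdn_divisors // => z_dvd.
have z_lt : (z < k)%N by rewrite ltn_neqAle z_neq dvdn_leq.
rewrite ifF //; apply/negbTE/forallPn; exists (Ordinal z_lt).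
by rewrite /= (dvdn_gt0 k_gt0 z_dvd) dvdnn.
Qed.

(** * Nonzero entries of the cores *)

Definition divisor_summatory (n : nat) : nat := (\sum_(1 <= j < n.+1) n %/ j)%N.

Lemma nzE n r s (G : 'I_n -> 'M[int]_(r, s)) :
  nz G = (\sum_i \sum_a \sum_b (G i a b != 0%R))%N.
Proof.
rewrite /nz -sum1dep_card big_mkcond pair_bigA pair_bigA /=.
by apply: eq_bigr => t _; case: (_ != _).
Qed.

Lemma sum_dvdn_summatory n :
  (\sum_(i < n) \sum_(j < n) (j.+1 %| i.+1))%N = divisor_summatory n.
Proof.
rewrite exchange_big /divisor_summatory big_add1 big_mkord.
by apply: eq_bigr => j _; rewrite divn_count_dvd big_add1 big_mkord.
Qed.

Lemma smithE_neq0 i j : (smithE i j != 0) = (j %| i)%N.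
Proof. by rewrite /smithE; case: ifP. Qed.

Lemma nz_core_last n : nz (@core_last n) = divisor_summatory n.
Proof.
rewrite nzE -sum_dvdn_summatory; apply: eq_bigr => i _; apply: eq_bigr => j _.
by rewrite big_ord1 mxE smithE_neq0.
Qed.

Lemma nz_core_mid n : nz (@core_mid n) = divisor_summatory n.
Proof.
rewrite nzE -sum_dvdn_summatory; apply: eq_bigr => i _; apply: eq_bigr => j _.
rewrite (bigD1 j) //= mxE eqxx mul1r smithE_neq0 big1 ?addn0 // => k kj.
by rewrite mxE [j == k]eq_sym (negbTE kj) mul0r eqxx.
Qed.

Lemma nz_core_first n : nz (@core_first n) = divisor_summatory n.
Proof.
rewrite nzE -sum_dvdn_summatory; apply: eq_bigr => i _.
rewrite big_ord1; apply: eq_bigr => j _.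
rewrite mxE mulf_eq0 negb_or smithE_neq0 smithD_totient // eqz_nat -lt0n.
by rewrite totient_gt0.
Qed.

(** * The hyperbola method *)

(** Writing [n %/ j] as a number of lattice points [(j, k)] with [j k <= n]
    makes the symmetry between [j] and [k] available. *)
Lemma divn_count_leq n j : (0 < j)%N ->
  (n %/ j = \sum_(1 <= k < n.+1) (j * k <= n))%N.
Proof.
move=> j_gt0; under eq_bigr do rewrite mulnC -leq_divRL //.
set q := (n %/ j)%N; have q_le : (q <= n)%N := leq_div _ _.
rewrite (@big_cat_nat _ _ _ q.+1) //= ?ltnS //.
rewrite [X in (_ + X)%N]big1_seq; last first.
  move=> k /andP[_]; rewrite mem_index_iota => /andP[q_lt _].
  by rewrite leqNgt q_lt.
rewrite addn0 (@eq_big_nat _ _ _ _ _ _ (fun=> 1%N)).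
  by rewrite sum_nat_const_nat muln1 subn1.
by move=> k /andP[_]; rewrite ltnS => ->.
Qed.

(** Dirichlet's hyperbola method: every point with [j k <= n] has [j <= u] or
    [k <= u], the two halves are mirror images, and they overlap in the full
    square [j, k <= u]. *)
Lemma hyperbola n u : (u * u <= n < u.+1 * u.+1)%N ->
  (divisor_summatory n + u * u = 2 * \sum_(1 <= j < u.+1) n %/ j)%N.
Proof.
case/andP=> u_le u_gt; have un : (u <= n)%N by nia.
set A := (X in (2 * X)%N).
pose B := (\sum_(u.+1 <= j < n.+1) \sum_(1 <= k < u.+1) (j * k <= n))%N.
(* For [j > u] only [k <= u] can occur, since [(u + 1) ^ 2 > n]. *)
have TE : divisor_summatory n = (A + B)%N.
  rewrite /divisor_summatory (@big_cat_nat _ _ _ u.+1) //=; congr addn.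
  apply: eq_big_nat => j /andP[j_gt j_le].
  rewrite divn_count_leq ?(leq_trans _ j_gt) // (@big_cat_nat _ _ _ u.+1) //=.
  rewrite [X in (_ + X)%N]big1_seq ?addn0 // => k /andP[_].
  rewrite mem_index_iota => /andP[k_gt _]; apply/eqP.
  by rewrite eqb0 -ltnNge; nia.
(* For [j <= u] all [k <= u] occur; the rest is the mirror image of [B]. *)
have AE : A = (u * u + B)%N.
  rewrite /B exchange_big /=.
  transitivity (\sum_(1 <= j < u.+1)
                  (u + \sum_(u.+1 <= k < n.+1) (k * j <= n)))%N.
    apply: eq_big_nat => j /andP[j_gt0 j_le].
    rewrite divn_count_leq // (@big_cat_nat _ _ _ u.+1) //=; congr addn.
      rewrite (@eq_big_nat _ _ _ _ _ _ (fun=> 1%N)).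
        by rewrite sum_nat_const_nat muln1 subn1.
      by move=> k /andP[_ k_le]; apply/eqP; rewrite eqb1; nia.
    by apply: eq_bigr => k _; rewrite mulnC.
  by rewrite big_split /= sum_nat_const_nat subn1.
by rewrite TE AE; lia.
Qed.

(** * The Euler-Mascheroni constant *)

(** Concavity: the graph of [ln] lies below its tangent at [x]. *)
Lemma ln_ratio_le (R : realType) (x y : R) : 0 < x -> 0 < y ->
  ln y - ln x <= (y - x) / x.
Proof.
move=> x_gt0 y_gt0; rewrite -ln_div ?posrE //.
have -> : y / x = 1 + (y - x) / x by field; rewrite gt_eqF.
apply: le_ln1Dx; rewrite ltr_pdivlMr //; lra.
Qed.

Lemma lnS_bounds (R : realType) (n : nat) : (0 < n)%N ->
  n.+1%:R^-1 <= ln (n.+1%:R : R) - ln n%:R <= n%:R^-1.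
Proof.
rewrite -(ltr0n R) -natr1; move: n%:R => x x_gt0.
have x1_gt0 : 0 < x + 1 by rewrite addr_gt0.
have := ln_ratio_le R _ _ x_gt0 x1_gt0.
have -> : (x + 1 - x) / x = x^-1 by field; rewrite gt_eqF.
have := ln_ratio_le R _ _ x1_gt0 x_gt0.
have -> : (x - (x + 1)) / (x + 1) = - (x + 1)^-1 by field; rewrite gt_eqF.
lra.
Qed.

Lemma harmonic_sub_ln_nonincreasing (R : realType) :
  nonincreasing_seq (fun n : nat => series (@harmonic R) n.+1 - ln n.+1%:R).
Proof.
apply/nonincreasing_seqP => n.
rewrite (seriesSr _ n.+1) -[harmonic n.+1]/(n.+2%:R^-1).
have /andP[] := lnS_bounds R n.+1 isT.
move: (series _ _) (ln _) (ln _) (_^-1) (_^-1) => S a b c d; lra.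
Qed.

Lemma harmonic_sub_lnS_nondecreasing (R : realType) :
  nondecreasing_seq (fun n : nat => series (@harmonic R) n - ln n.+1%:R).
Proof.
apply/nondecreasing_seqP => n; rewrite seriesSr -[harmonic n]/(n.+1%:R^-1).
have /andP[] := lnS_bounds R n.+1 isT.
move: (series _ _) (ln _) (ln _) (_^-1) (_^-1) => S a b c d; lra.
Qed.

(** [H_n - ln n] decreases for [n > 0] and stays above every value of the
    increasing sequence [H_n - ln (n + 1)].  So it converges, its limit [gamma]
    lies between the two sequences, and their gap [ln (n + 1) - ln n] is at
    most [1 / n]. *)
Lemma harmonic_ln_euler (R : realType) (n : nat) : (0 < n)%N ->
  0 <= series (@harmonic R) n - ln n%:R - euler_mascheroni R <= n%:R^-1.
Proof.
case: n => // n _.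
set a := fun n : nat => series (@harmonic R) n - ln n%:R.
set b := fun n : nat => series (@harmonic R) n - ln n.+1%:R.
have b_le_a k m : (b k <= a m.+1).
  set l := maxn k m.+1.
  apply: (@le_trans _ _ (b l)).
    by apply: harmonic_sub_lnS_nondecreasing; rewrite leq_maxl.
  have l_gt0 : (0 < l)%N by rewrite leq_max orbT.
  apply: (@le_trans _ _ (a l)).
    by rewrite lerD2l lerN2 ler_ln ?posrE ?ltr0n // ler_nat.
  rewrite -(prednK l_gt0); apply: (@harmonic_sub_ln_nonincreasing R).
  by rewrite -ltnS prednK // leq_maxr.
(* The shift by one avoids the index [0], where [ln 0 = 0] breaks
   monotonicity of [a]. *)
have cvg_aS : cvgn (fun m => a m.+1).
  apply: nonincreasing_is_cvgn; first exact: harmonic_sub_ln_nonincreasing.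
  by exists (b 0%N) => _ [m _ <-]; exact: b_le_a.
have gE : euler_mascheroni R = limn (fun m => a m.+1).
  by apply/cvg_lim => //; rewrite -(cvg_shiftS a); exact: cvg_aS.
have g_le : euler_mascheroni R <= a n.+1.
  rewrite gE; apply: (@nonincreasing_cvgn_ge _ (fun m => a m.+1)) => //.
  exact: harmonic_sub_ln_nonincreasing.
have g_ge : b n.+1 <= euler_mascheroni R.
  by rewrite gE; apply: limr_ge => //; apply: nearW => m; exact: b_le_a.
have /andP[_] := lnS_bounds R n.+1 isT.
move: g_le g_ge; rewrite /a /b.
move: (series _ _) (ln _) (ln _) (_^-1) (euler_mascheroni R) => S c d x g; lra.
Qed.

(** * The divisor summatory function *)

Lemma divn_bounds (R : realType) (n j : nat) : (0 < j)%N ->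
  n%:R / j%:R - 1 <= ((n %/ j)%:R : R) <= n%:R / j%:R.
Proof.
move=> j_gt0; rewrite lerBlDr natr1 ler_pdivrMr ?ltr0n // ler_pdivlMr ?ltr0n //.
by rewrite -!natrM !ler_nat leq_divM ltnW // ltn_ceil.
Qed.

Lemma sum_divn_harmonic (R : realType) (n u : nat) :
  n%:R * series (@harmonic R) u - u%:R
    <= ((\sum_(1 <= j < u.+1) n %/ j)%N%:R : R)
    <= n%:R * series (@harmonic R) u.
Proof.
rewrite natr_sum big_add1 /= /series /= mulr_sumr; apply/andP; split.
  have -> : u%:R = \sum_(0 <= j < u) 1 :> R by rewrite sumr_const_nat subn0.
  rewrite -sumrB; apply: ler_sum => j _.
  by have /andP[] := @divn_bounds R n j.+1 isT.
by apply: ler_sum => j _; have /andP[] := @divn_bounds R n j.+1 isT.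
Qed.

Lemma ex_isqrt n : exists u, (u * u <= n < u.+1 * u.+1)%N.
Proof.
elim: n => [|n [u /andP[u_le u_gt]]]; first by exists 0%N.
have [|] := leqP (u.+1 * u.+1) n.+1 => h; [exists u.+1 | exists u]; nia.
Qed.

(** The errors, in units of [u <= sqrt n]: at most [2] from the floors (taken
    twice), at most [2 * 3] from [H_u] and, with opposite sign, at most [6] from
    [2 ln u], and at most [2] from [u ^ 2]; errors of equal sign add up to at
    most [8]. *)
Lemma divisor_summatory_bound (R : realType) (n : nat) : (0 < n)%N ->
  `|(divisor_summatory n)%:R
    - (n%:R * ln n%:R + (2 * euler_mascheroni R - 1) * n%:R)|
  <= 8 * Num.sqrt n%:R :> R.
Proof.
move=> n_gt0; have [u u_bounds] := ex_isqrt n.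
have /(congr1 (fun k => k%:R : R)) := hyperbola _ _ u_bounds.
rewrite natrD !natrM; have /andP[] := sum_divn_harmonic R n u.
set S : R := (\sum_(1 <= j < u.+1) n %/ j)%N%:R => S_ge S_le TE.
have u_gt0 : (0 < u)%N by case: u u_bounds {S S_ge S_le TE} => //; lia.
have /andP[u_le u_gt] := u_bounds.
have /andP[] := harmonic_ln_euler R u u_gt0.
move: S_ge S_le TE.
have x_gt0 : 0 < n%:R :> R by rewrite ltr0n.
have y_gt0 : 0 < u%:R :> R by rewrite ltr0n.
have y_le : u%:R * u%:R <= n%:R :> R by rewrite -natrM ler_nat.
have x_le : n%:R <= u%:R * u%:R + 2 * u%:R :> R.
  by rewrite -!natrM -natrD ler_nat; lia.
have y_ge1 : 1 <= u%:R :> R by rewrite ler1n.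
have yy_gt0 : 0 < u%:R * u%:R :> R by rewrite mulr_gt0.
have lnyy : ln (u%:R * u%:R) = 2 * ln u%:R :> R by rewrite lnM ?posrE //; ring.
have yy_le_x : 2 * ln u%:R <= ln n%:R :> R by rewrite -lnyy ler_ln ?posrE.
have ln_le := @ln_ratio_le R _ _ yy_gt0 x_gt0.
have sqrt_ge : u%:R <= Num.sqrt n%:R :> R.
  by rewrite -[leLHS](ger0_norm (ltW y_gt0)) -sqrtr_sqr ler_wsqrtr // expr2.
(* What is left is an inequality between real numbers: [x] and [y] stand for
   [n] and [u], [H] for the harmonic number, [g] for [gamma]. *)
move: sqrt_ge ln_le; rewrite lnyy.
move: (divisor_summatory n)%:R S (series _ _) (euler_mascheroni R) (Num.sqrt _).
move: (ln u%:R) (ln n%:R) yy_le_x => lu ln {lnyy} lu_le.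
move=> T S H g s s_ge ln_le S_ge S_le TE Ha Hb.
move: s_ge ln_le S_ge S_le TE Ha Hb.
move: u%:R n%:R x_gt0 y_gt0 y_le x_le y_ge1 yy_gt0.
move=> y x x_gt0 y_gt0 y_le x_le y_ge1 yy_gt0.
move=> s_ge ln_le S_ge S_le TE Ha Hb.
(* Since [y >= 1], [x / y <= 3 y]: an error [O(1 / y)], once multiplied by
   [x], is [O(y)]. *)
have xy_le : x <= 3 * y * y by nra.
have a_ge0 : 0 <= x * (H - lu - g) by rewrite mulr_ge0 // ltW.
have a_le : x * (H - lu - g) <= 3 * y.
  apply: (@le_trans _ _ (x * y^-1)); first by rewrite ler_wpM2l // ltW.
  by rewrite ler_pdivrMr.
have b_ge0 : 0 <= x * (ln - 2 * lu) by rewrite mulr_ge0 ?subr_ge0 // ltW.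
have b_le : x * (ln - 2 * lu) <= 6 * y.
  apply: (@le_trans _ _ (x * ((x - y * y) / (y * y)))).
    by rewrite ler_wpM2l // ltW.
  by rewrite mulrA ler_pdivrMr //; nra.
apply: (@le_trans _ _ (8 * y)); last by rewrite ler_pM2l.
rewrite ler_norml; apply/andP; split; lra.
Qed.

Lemma divisor_summatory_bigO (R : realType) (f : nat -> nat) :
  (forall n, f n = divisor_summatory n) ->
  (fun n : nat => (f n)%:R : R) =
     (fun n : nat => n%:R * ln n%:R + (2 * euler_mascheroni R - 1) * n%:R : R)
       +O_\oo (fun n : nat => Num.sqrt n%:R : R).
Proof.
move=> fE; apply/eqaddOP; exists 8; split; first by rewrite num_real.
move=> k k_gt; near=> n.
have n_gt0 : (0 < n)%N by near: n; exact: nbhs_infty_gt.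
rewrite [X in _ <= _ * X]ger0_norm ?sqrtr_ge0 // !fctE fE.
apply: (le_trans (divisor_summatory_bound R n n_gt0)).
by rewrite ler_wpM2r ?sqrtr_ge0 // ltW.
Unshelve. all: by end_near.
Qed.

Theorem corollary4p3 (R : realType) :
  let main_term := fun n : nat =>
    n%:R * ln n%:R + (2 * euler_mascheroni R - 1) * n%:R : R in
  [/\ (fun n : nat => (nz (@core_first n))%:R : R)
        = main_term +O_\oo (fun n : nat => Num.sqrt n%:R : R),
      (fun n : nat => (nz (@core_mid n))%:R : R)
        = main_term +O_\oo (fun n : nat => Num.sqrt n%:R : R) &
      (fun n : nat => (nz (@core_last n))%:R : R)
        = main_term +O_\oo (fun n : nat => Num.sqrt n%:R : R)].
Proof.
by split; apply: divisor_summatory_bigO => n;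
  rewrite ?nz_core_first ?nz_core_mid ?nz_core_last.
Qed.
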